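(* Let $\boldsymbol{x}=\boldsymbol{H}\boldsymbol{y}+\boldsymbol{n}$, where $\boldsymbol{H}$ is a fixed matrix, $\boldsymbol{y}$ is drawn from a (fictitious) prior, and $\boldsymbol{n}$ is a zero-mean random vector with covariance $\boldsymbol{\Sigma}_n$, independent of $\boldsymbol{y}$. Consider linear estimators $\hat{\boldsymbol{y}}=\boldsymbol{A}\boldsymbol{x}$ and, for $\lambda\ge 0$, the linear BCE defined (in the limit $N,M\to\infty$ of infinitely many training samples) as the minimizer over $\boldsymbol{A}$ of $$\mathrm{E}\big[\|\boldsymbol{A}\boldsymbol{x}-\boldsymbol{y}\|^2\big]+\lambda\,\mathrm{E}\Big[\big\|\mathrm{E}[\boldsymbol{A}\boldsymbol{x}-\boldsymbol{y}\mid\boldsymbol{y}]\big\|^2\Big],$$ all expectations over $\boldsymbol{y}$ being with respect to the fictitious prior. Let $\mathbf{R}=\mathrm{E}\big[\mathrm{E}[\boldsymbol{x}\mid\boldsymbol{y}]\,\mathrm{E}[\boldsymbol{x}^T\mid\boldsymbol{y}]\big]$ and $\boldsymbol{\Sigma}_{\boldsymbol{y}}=\mathrm{E}[\boldsymbol{y}\boldsymbol{y}^T]$, and assume all matrices being inverted below are invertible. Then the linear BCE is $$\boldsymbol{A}=\mathrm{E}[\boldsymbol{y}\boldsymbol{x}^T]\Big(\tfrac{1}{\lambda+1}\mathrm{E}[\boldsymbol{x}\boldsymbol{x}^T]+\tfrac{\lambda}{\lambda+1}\mathbf{R}\Big)^{-1}=\Big(\boldsymbol{H}^T\boldsymbol{\Sigma}_n^{-1}\boldsymbol{H}+\tfrac{1}{\lambda+1}\boldsymbol{\Sigma}_{\boldsymbol{y}}^{-1}\Big)^{-1}\boldsymbol{H}^T\boldsymbol{\Sigma}_n^{-1}.$$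 *)

(* Defs.v *)
From HB Require Import structures.
From mathcomp Require Import all_boot all_order all_algebra.
From mathcomp Require Import all_classical all_reals all_analysis.
Set Implicit Arguments. Unset Strict Implicit. Unset Printing Implicit Defensive.
Import Order.TTheory GRing.Theory Num.Theory.
Local Open Scope classical_set_scope.
Local Open Scope ring_scope.

Section Defs.
Context {d : measure_display} {T : measurableType d} {R : realType}
  (P : probability T R).

Definition Eb (f : T -> R) : \bar R := (\int[P]_w (f w)%:E)%E.
Definition Er (f : T -> R) : R := fine (Eb f).

Definition sigma_gen {k : nat} (y : T -> 'cV[R]_k) : set (set T) :=
  [set A | exists i : 'I_k, exists B : set R,
     measurable B /\ A = (fun w => y w i 0) @^-1` B].
Definition sigma_of {k : nat} (y : T -> 'cV[R]_k) : set (set T) :=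
  <<s sigma_gen y >>.

Definition second_moment {k l : nat} (u : T -> 'cV[R]_k) (v : T -> 'cV[R]_l)
  : 'M[R]_(k, l) := \matrix_(i, j) Er (fun w => u w i 0 * v w j 0).

Definition is_condexp {k l : nat} (y : T -> 'cV[R]_k) (X Z : T -> 'cV[R]_l)
  : Prop :=
  forall i : 'I_l,
    (forall B : set R, measurable B ->
        sigma_of y ((fun w => Z w i 0) @^-1` B)) /\
    P.-integrable setT (fun w => (Z w i 0)%:E) /\
    (forall G, sigma_of y G ->
        (\int[P]_(w in G) (Z w i 0)%:E = \int[P]_(w in G) (X w i 0)%:E)%E).

Definition indep_vec {k l : nat} (y : T -> 'cV[R]_k) (n : T -> 'cV[R]_l)
  : Prop :=
  forall A B, sigma_of y A -> sigma_of n B -> P (A `&` B) = (P A * P B)%E.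

Definition sqn {k : nat} (v : 'cV[R]_k) : R := \sum_(i < k) v i 0 ^+ 2.

(* the BCE cost of the linear estimator A x, where cond A is a version of
   E[A x - y | y] *)
Definition bce_cost {p m : nat} (lam : R) (x : T -> 'cV[R]_m)
  (y : T -> 'cV[R]_p) (cond : 'M[R]_(p, m) -> T -> 'cV[R]_p)
  (A : 'M[R]_(p, m)) : \bar R :=
  (Eb (fun w => sqn (A *m x w - y w)) + lam%:E * Eb (fun w => sqn (cond A w)))%E.

End Defs.

(* Main.v *)
Require Import Defs.
From HB Require Import structures.
From mathcomp Require Import all_boot all_order all_algebra.
From mathcomp Require Import all_classical all_reals all_analysis.
From mathcomp Require Import measurable_realfun ring lra.
Import Order.TTheory GRing.Theory Num.Theory.
Local Open Scope classical_set_scope.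
Local Open Scope ring_scope.

(** Independence and E[n] = 0 give E[n | y] = 0, hence E[C y + D n | y] = C y
almost surely and E[y n^T] = 0.  With S = E[y y^T] and N = E[n n^T], the cost of
a linear estimator B is then the quadratic form
(lam+1) tr((B H - 1) S (B H - 1)^T) + tr(B N B^T), whose normal equations are
A (H S H^T + N/(lam+1)) = S H^T.  Completing the square around A leaves
(lam+1) E|(B-A) H y|^2 + E|(B-A) n|^2, which is nonnegative and vanishes only if
(B-A) N = 0, that is B = A.  The second closed form is the push-through
identity. *)

(** * Product rule for expectations of independent real variables *)

Section Independence.
Context {d : measure_display} {T : measurableType d} {R : realType}
  (P : probability T R).

(** Independence makes the joint law of [X] and [Y] the product of their laws; Fubini then splits
    the integral of [z.1 * z.2]. *)
Lemma expectation_mul_indep (X Y : {mfun T >-> R}) :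
  P.-integrable setT (EFin \o X) -> P.-integrable setT (EFin \o Y) ->
  P.-integrable setT (EFin \o (X \* Y)) ->
  (forall A B, measurable A -> measurable B ->
     P (X @^-1` A `&` Y @^-1` B) = (P (X @^-1` A) * P (Y @^-1` B))%E) ->
  Eb P (X \* Y) = (Eb P X * Eb P Y)%E.
Proof.
move=> iX iY iXY XY.
have mXY : measurable_fun setT (fun w => (X w, Y w)).
  exact: measurable_fun_pair.
pose XYm : {mfun T >-> (R * R)%type} := mfun_Sub (mem_set mXY).
pose mu := distribution P XYm.
pose mX := distribution P X; pose mY := distribution P Y.
(* A product measure is determined by its values on rectangles, where the joint law factors by
   [XY]. *)
have muE A : measurable A -> (mX \x mY)%E A = mu A.
  by apply: product_measure_unique => {}A B mA mB; rewrite -XY.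
have mfs : measurable_fun setT (fun z : R * R => z.1 * z.2).
  by apply: measurable_funM.
pose f := EFin \o (fun z : R * R => z.1 * z.2).
have mf := proj2 (measurable_EFinP _ _) mfs.
have imu : mu.-integrable setT f.
  by apply: integrable_pushforward.
have iprod : (mX \x mY)%E.-integrable setT f.
  apply/integrableP; split => //.
  rewrite (eq_measure_integral mu) => [|A mA _]; last exact: muE.
  by case/integrableP : imu.
have -> : Eb P (X \* Y) = (\int[mu]_z f z)%E.
  by rewrite integral_pushforward.
rewrite (eq_measure_integral (mX \x mY)%E) => [|A mA _]; last exact: esym (muE A mA).
rewrite -integral12_prod_meas1// /fubini_F /f /=.
have iY' : mY.-integrable setT (EFin : R -> \bar R).
  by apply: integrable_pushforward => //; exact/measurable_EFinP.
have iX' : mX.-integrable setT (EFin : R -> \bar R).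
  by apply: integrable_pushforward => //; exact/measurable_EFinP.
have EY : (\int[mY]_z z%:E = Eb P Y)%E.
  by rewrite integral_pushforward//; exact/measurable_EFinP.
have EX : (\int[mX]_z z%:E = Eb P X)%E.
  by rewrite integral_pushforward//; exact/measurable_EFinP.
(* Finiteness turns [Eb P Y] into a real scalar that can be pulled out of the outer integral. *)
have finY : Eb P Y \is a fin_num by exact: integrable_fin_num.
under eq_integral => z _.
  under eq_integral => z' _ do rewrite EFinM.
  rewrite integralZl// EY -(fineK finY) muleC; over.
by rewrite integralZl// EX (fineK finY) muleC.
Qed.

End Independence.

(** * Square-integrable vectors and the bilinear calculus of second moments *)

Section SquareIntegrable.
Context {d : measure_display} {T : measurableType d} {R : realType}
  (P : probability T R).

(** Measurability of [f] is a separate clause because that of [f ^+ 2] does not imply it. *)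
Definition square_integrable (f : T -> R) : Prop :=
  measurable_fun setT f /\ P.-integrable setT (fun w => (f w ^+ 2)%:E).

(** Domination by the integrable function [f ^+ 2 + g ^+ 2]. *)
Lemma square_integrable_mul (f g : T -> R) :
  square_integrable f -> square_integrable g ->
  P.-integrable setT (fun w => (f w * g w)%:E).
Proof.
move=> [mf if2] [mg ig2].
apply: (le_integrable _ _ _ (integrableD _ if2 ig2)) => //.
  by apply/measurable_EFinP; by apply: measurable_funM.
move=> w _ /=; rewrite lee_fin normrM [leRHS]ger0_norm ?addr_ge0 ?sqr_ge0//.
rewrite -[f w ^+ 2]real_normK ?num_real// -[g w ^+ 2]real_normK ?num_real//.
move: (`|f w| : R) (`|g w| : R) => a b.
by have := (sqr_ge0 a, sqr_ge0 b, sqr_ge0 (a - b)) => -[[]]; nra.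
Qed.

Lemma square_integrable_cst (c : R) : square_integrable (cst c).
Proof. by split=> //; exact: (finite_measure_integrable_cst P (c ^+ 2)). Qed.

Lemma square_integrable_integrable (f : T -> R) :
  square_integrable f -> P.-integrable setT (fun w => (f w)%:E).
Proof.
move=> sf; have := square_integrable_mul _ _ sf (square_integrable_cst 1).
by apply: eq_integrable => // w _; rewrite /= mulr1.
Qed.

Lemma square_integrableD (f g : T -> R) :
  square_integrable f -> square_integrable g ->
  square_integrable (fun w => f w + g w).
Proof.
move=> sf sg; split; first by apply: measurable_funD; [case: sf|case: sg].
have [_ if2] := sf; have [_ ig2] := sg.
have ifg := square_integrable_mul _ _ sf sg.
have i1 := integrableD measurableT if2 ig2.
have i2 := integrableD measurableT i1 (integrableZl measurableT 2 ifg).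
by apply: eq_integrable i2 => // w _; rewrite -EFinM -!EFinD; congr EFin; ring.
Qed.

Lemma square_integrableZ (c : R) (f : T -> R) :
  square_integrable f -> square_integrable (fun w => c * f w).
Proof.
move=> [mf if2]; split; first by apply: measurable_funM.
apply: eq_integrable (integrableZl measurableT (c ^+ 2) if2) => // w _.
by rewrite -EFinM exprMn.
Qed.

Lemma square_integrable_sum (I : Type) (s : seq I) (f : I -> T -> R) :
  (forall i, square_integrable (f i)) ->
  square_integrable (fun w => \sum_(i <- s) f i w).
Proof.
move=> sf; elim: s => [|i s IHs].
  by under eq_fun => w do rewrite big_nil; exact: square_integrable_cst.
by under eq_fun => w do rewrite big_cons; exact: square_integrableD.
Qed.

Definition square_integrable_vec {k} (u : T -> 'cV[R]_k) : Prop :=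
  forall i, square_integrable (fun w => u w i 0).

Lemma square_integrable_vec_mulmx {k l} (B : 'M[R]_(l, k)) (u : T -> 'cV[R]_k) :
  square_integrable_vec u -> square_integrable_vec (fun w => B *m u w).
Proof.
move=> su i; under eq_fun => w do rewrite mxE.
by apply: square_integrable_sum => j; exact: square_integrableZ.
Qed.

Lemma square_integrable_vecD {k} (u v : T -> 'cV[R]_k) :
  square_integrable_vec u -> square_integrable_vec v ->
  square_integrable_vec (fun w => u w + v w).
Proof.
by move=> su sv i; under eq_fun => w do rewrite mxE; exact: square_integrableD.
Qed.

Lemma second_moment_tr {k l} (u : T -> 'cV[R]_k) (v : T -> 'cV[R]_l) :
  (second_moment P u v)^T = second_moment P v u.
Proof.
by apply/matrixP => i j; rewrite !mxE; congr Er; apply/funext => w; rewrite mulrC.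
Qed.

Lemma second_momentDl {k l} (u u' : T -> 'cV[R]_k) (v : T -> 'cV[R]_l) :
  square_integrable_vec u -> square_integrable_vec u' ->
  square_integrable_vec v ->
  second_moment P (fun w => u w + u' w) v =
  second_moment P u v + second_moment P u' v.
Proof.
move=> su su' sv; apply/matrixP => i j; rewrite !mxE.
rewrite -RintegralD//; [|exact: square_integrable_mul..].
by congr Er; apply/funext => w; rewrite mxE mulrDl.
Qed.

Lemma integrable_EFin_sum (I : Type) (s : seq I) (f : I -> T -> R) :
  (forall i, P.-integrable setT (fun w => (f i w)%:E)) ->
  P.-integrable setT (fun w => (\sum_(i <- s) f i w)%:E).
Proof.
move=> fi; under eq_fun => w do rewrite -sumEFin.
exact: integrable_sum.
Qed.

Lemma Er_sum (I : Type) (s : seq I) (f : I -> T -> R) :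
  (forall i, P.-integrable setT (fun w => (f i w)%:E)) ->
  Er P (fun w => \sum_(i <- s) f i w) = \sum_(i <- s) Er P (f i).
Proof.
move=> fi; elim: s => [|i s IHs].
  rewrite big_nil; under eq_fun => w do rewrite big_nil.
  by rewrite /Er /Eb integral0.
rewrite big_cons -IHs; under eq_fun => w do rewrite big_cons.
by rewrite /Er /Eb -[LHS]/(Rintegral P setT _) RintegralD//;
  [exact: fi | exact: integrable_EFin_sum].
Qed.

Lemma second_moment_mulmxl {k k' l} (B : 'M[R]_(k', k)) (u : T -> 'cV[R]_k)
    (v : T -> 'cV[R]_l) :
  square_integrable_vec u -> square_integrable_vec v ->
  second_moment P (fun w => B *m u w) v = B *m second_moment P u v.
Proof.
move=> su sv; apply/matrixP => i j; rewrite !mxE.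
have -> : (fun w => (B *m u w) i 0 * v w j 0) =
    (fun w => \sum_a B i a * (u w a 0 * v w j 0)).
  apply/funext => w; rewrite mxE mulr_suml.
  by apply: eq_bigr => a _; rewrite mulrA.
rewrite Er_sum => [|a].
  apply: eq_bigr => a _; rewrite mxE -RintegralZl//.
  exact: square_integrable_mul.
have := integrableZl measurableT (B i a) (square_integrable_mul _ _ (su a) (sv j)).
by apply: eq_integrable.
Qed.

Lemma second_momentDr {k l} (u : T -> 'cV[R]_k) (v v' : T -> 'cV[R]_l) :
  square_integrable_vec u -> square_integrable_vec v ->
  square_integrable_vec v' ->
  second_moment P u (fun w => v w + v' w) =
  second_moment P u v + second_moment P u v'.
Proof.
by move=> su sv sv'; rewrite -second_moment_tr second_momentDl// linearD/=
  !second_moment_tr.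
Qed.

Lemma second_moment_mulmxr {k l l'} (B : 'M[R]_(l', l)) (u : T -> 'cV[R]_k)
    (v : T -> 'cV[R]_l) :
  square_integrable_vec u -> square_integrable_vec v ->
  second_moment P u (fun w => B *m v w) = second_moment P u v *m B^T.
Proof.
by move=> su sv; rewrite -second_moment_tr second_moment_mulmxl// trmx_mul
  second_moment_tr.
Qed.

(** Passage from the extended-real cost to matrix algebra: the squared norm sums the squares whose
    expectations form the diagonal of the second moment. *)
Lemma Eb_sqn {k} (u : T -> 'cV[R]_k) : square_integrable_vec u ->
  Eb P (fun w => sqn (u w)) = (\tr (second_moment P u u))%:E.
Proof.
move=> su; have i2 i : P.-integrable setT (fun w => (u w i 0 ^+ 2)%:E).
  by case: (su i).
rewrite -[LHS]fineK; last first.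
  by apply: integrable_fin_num => //; exact: integrable_EFin_sum.
congr EFin; rewrite -/(Er P _) /sqn Er_sum//.
by apply: eq_bigr => i _; rewrite mxE.
Qed.

End SquareIntegrable.

(** * Conditional expectation given [y]: uniqueness, and its value for affine functions of
    independent noise *)

Section ConditionalExpectation.
Context {d : measure_display} {T : measurableType d} {R : realType}
  (P : probability T R).

Lemma sigma_of_measurable {k} (y : T -> 'cV[R]_k) :
  (forall i, measurable_fun setT (fun w => y w i 0)) ->
  sigma_of y `<=` measurable.
Proof.
move=> my; apply: smallest_sub; first exact: sigma_algebra_measurable.
by move=> _ [i [B [mB ->]]]; rewrite -[X in measurable X]setTI; exact: my.
Qed.

Lemma sigma_of_preimage {k} (y : T -> 'cV[R]_k) (i : 'I_k) (B : set R) :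
  measurable B -> sigma_of y ((fun w => y w i 0) @^-1` B).
Proof. by move=> mB; apply: sub_sigma_algebra; exists i, B. Qed.

(** On [T] equipped with the sigma-algebra of [y], the coordinates of [y] are measurable, hence so
    are their finite linear combinations. *)
Lemma sigma_of_mulmx {k l} (y : T -> 'cV[R]_k) (C : 'M[R]_(l, k)) (i : 'I_l)
    (B : set R) :
  measurable B -> sigma_of y ((fun w => (C *m y w) i 0) @^-1` B).
Proof.
move=> mB.
pose S := g_sigma_algebraType (sigma_gen y).
have my j : measurable_fun setT (fun w : S => y w j 0).
  by move=> _ D mD; rewrite setTI; exact: sigma_of_preimage.
have mC : measurable_fun setT (fun w : S => \sum_j C i j * y w j 0).
  by apply: measurable_sum => j; apply: measurable_funM.
under eq_fun => w do rewrite mxE.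
by have := mC measurableT _ mB; rewrite setTI.
Qed.

(* Both versions are compared under P restricted to the sigma-algebra generated
   by y, obtained as the image of P under the identity. *)
Lemma condexp_unique {k l} (y : T -> 'cV[R]_k) (X Z Z' : T -> 'cV[R]_l) :
  (forall i, measurable_fun setT (fun w => y w i 0)) ->
  is_condexp P y X Z -> is_condexp P y X Z' ->
  forall i, ae_eq P setT (fun w => Z w i 0) (fun w => Z' w i 0).
Proof.
move=> my hZ hZ' i.
have [mZ [iZ eZ]] := hZ i; have [mZ' [iZ' eZ']] := hZ' i.
pose S := g_sigma_algebraType (sigma_gen y).
have mid : measurable_fun setT (idfun : T -> S).
  move=> _ B mB; rewrite setTI; exact: sigma_of_measurable mB.
pose idS : {mfun T >-> S} := mfun_Sub (mem_set mid).
pose mu := distribution P idS.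
have mZS : measurable_fun setT (fun w : S => Z w i 0).
  by move=> _ B mB; rewrite setTI; exact: mZ.
have mZS' : measurable_fun setT (fun w : S => Z' w i 0).
  by move=> _ B mB; rewrite setTI; exact: mZ'.
have /measurable_EFinP eZS := mZS; have /measurable_EFinP eZS' := mZS'.
(* Measurable functions on [S] with equal integrals over all measurable sets agree almost
   everywhere; here both integrals equal that of [X]. *)
have : ae_eq mu setT (fun w : S => (Z w i 0)%:E) (fun w : S => (Z' w i 0)%:E).
  apply: integral_ae_eq => //.
    by apply: integrable_pushforward.
  move=> G _ mG.
  have mGT : measurable (G : set T) by exact: sigma_of_measurable mG.
  rewrite !integral_pushforward//.
  - by rewrite /= preimage_id [LHS]eZ// [RHS]eZ'.
  - exact: integrableS iZ'.
  - exact: integrableS iZ.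
(* The exceptional set for [mu] is also measurable in [T], and it has the same mass under [P]. *)
move=> [N [mN N0 sub]]; exists N; split => //.
  exact: sigma_of_measurable mN.
move=> w /= nw; apply: sub => /= h; apply: nw => _.
by have [] := h Logic.I.
Qed.

Lemma condexp_measurable {k l} (y : T -> 'cV[R]_k) (X Z : T -> 'cV[R]_l) :
  (forall i, measurable_fun setT (fun w => y w i 0)) ->
  is_condexp P y X Z -> forall i, measurable_fun setT (fun w => Z w i 0).
Proof.
move=> my hZ i _ B mB; rewrite setTI; have [mZ _] := hZ i.
exact: sigma_of_measurable (mZ _ mB).
Qed.

Lemma second_moment_ae_eq {k} (u v : T -> 'cV[R]_k) :
  (forall i, measurable_fun setT (fun w => u w i 0)) ->
  (forall i, measurable_fun setT (fun w => v w i 0)) ->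
  (forall i, ae_eq P setT (fun w => u w i 0) (fun w => v w i 0)) ->
  second_moment P u u = second_moment P v v.
Proof.
move=> mu mv uv; apply/matrixP => i j; rewrite !mxE; congr fine.
apply: ae_eq_integral => //.
- by apply/measurable_EFinP; exact: measurable_funM.
- by apply/measurable_EFinP; exact: measurable_funM.
by apply: filterS2 (uv i) (uv j) => w /= ui uj _; rewrite ui// uj.
Qed.

(** Lets an arbitrary version of a conditional expectation be replaced by an explicit one inside the
    cost. Only measurability is assumed, since a version is not known in advance to be square
    integrable. *)
Lemma Eb_sqn_ae_eq {k} (u v : T -> 'cV[R]_k) :
  (forall i, measurable_fun setT (fun w => u w i 0)) ->
  (forall i, measurable_fun setT (fun w => v w i 0)) ->
  (forall i, ae_eq P setT (fun w => u w i 0) (fun w => v w i 0)) ->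
  Eb P (fun w => sqn (u w)) = Eb P (fun w => sqn (v w)).
Proof.
move=> mu mv uv; apply: ae_eq_integral => //.
- by apply/measurable_EFinP; apply: measurable_sum => i; exact: measurable_funX.
- by apply/measurable_EFinP; apply: measurable_sum => i; exact: measurable_funX.
(* Finitely many coordinates, so the exceptional sets have a null union. *)
have : \forall w \ae P, forall i, setT w -> u w i 0 = v w i 0.
  by apply: (@filter_forall T 'I_k (fun i w => setT w -> u w i 0 = v w i 0)).
apply: filterS => w /= uvw _; congr EFin.
by apply: eq_bigr => i _; rewrite uvw.
Qed.

(** A variable measurable for the sigma-algebra of [y] is independent of each [n w j 0], so the
    expectation factors through the zero mean of the noise. It serves twice: with [f] a coordinate
    of [y], and with [f] an indicator. *)
Lemma indep_vec_integral0 {k l} (y : T -> 'cV[R]_k) (n : T -> 'cV[R]_l) :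
  (forall i, measurable_fun setT (fun w => y w i 0)) ->
  square_integrable_vec P n ->
  (forall j, Eb P (fun w => n w j 0) = 0%E) -> indep_vec P y n ->
  forall (f : T -> R) j, square_integrable P f ->
    (forall B, measurable B -> sigma_of y (f @^-1` B)) ->
    Eb P (fun w => f w * n w j 0) = 0%E.
Proof.
move=> my sn n0 yn f j sf fy; have [mf _] := sf; have [mn _] := sn j.
pose F : {mfun T >-> R} := mfun_Sub (mem_set mf).
pose N : {mfun T >-> R} := mfun_Sub (mem_set mn).
have := expectation_mul_indep P F N; rewrite [Eb P N]n0 mule0; apply.
- exact: square_integrable_integrable sf.
- exact: square_integrable_integrable (sn j).
- exact: square_integrable_mul sf (sn j).
by move=> A B mA mB; apply: yn; [exact: fy|exact: (sigma_of_preimage n j)].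
Qed.

Lemma second_moment_indep0 {k l} (y : T -> 'cV[R]_k) (n : T -> 'cV[R]_l) :
  square_integrable_vec P y -> square_integrable_vec P n ->
  (forall j, Eb P (fun w => n w j 0) = 0%E) -> indep_vec P y n ->
  second_moment P y n = 0.
Proof.
move=> sy sn n0 yn; apply/matrixP => i j; rewrite !mxE /Er.
rewrite (@indep_vec_integral0 _ _ y n)// => [i'|B]; first by case: (sy i').
exact: sigma_of_preimage.
Qed.

(** [C *m y] is already measurable for the sigma-algebra of [y], and [D *m n] integrates to zero
    over each of its sets. *)
Lemma condexp_affine_indep {k l q} (y : T -> 'cV[R]_k) (n : T -> 'cV[R]_l)
    (C : 'M[R]_(q, k)) (D : 'M[R]_(q, l)) :
  square_integrable_vec P y -> square_integrable_vec P n ->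
  (forall j, Eb P (fun w => n w j 0) = 0%E) -> indep_vec P y n ->
  is_condexp P y (fun w => C *m y w + D *m n w) (fun w => C *m y w).
Proof.
move=> sy sn n0 yn i.
have my j : measurable_fun setT (fun w => y w j 0) by case: (sy j).
have sC := square_integrable_vec_mulmx P C y sy i.
have sD := square_integrable_vec_mulmx P D n sn i.
split; first by move=> B; exact: sigma_of_mulmx.
split; first exact: square_integrable_integrable.
move=> G yG; have mG := sigma_of_measurable y my G yG.
have s1 : square_integrable P (\1_G : T -> R).
  split; first exact: measurable_indic.
  have := integrable_indic P mG; apply: eq_integrable => // w _.
  by rewrite indicE; case: (w \in G); rewrite ?expr1n ?expr0n.
have sig1 B : measurable B -> sigma_of y ((\1_G : T -> R) @^-1` B).
  move=> mB; pose S := g_sigma_algebraType (sigma_gen y).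
  have m1 : measurable_fun setT (\1_(G : set S) : S -> R).
    exact: measurable_indic.
  by have := m1 measurableT _ mB; rewrite setTI.
(* The integral over [G] is the expectation of the noise times the indicator of [G], which is an
   admissible [f] by [s1] and [sig1]. *)
have nG j : (\int[P]_(w in G) (n w j 0)%:E = 0)%E.
  rewrite integral_mkcond.
  rewrite -(@indep_vec_integral0 _ _ y n my sn n0 yn _ j s1 sig1).
  apply: eq_integral => w _; rewrite patchE indicE.
  by case: (w \in G); rewrite ?mul1r ?mul0r.
have inG j : P.-integrable G (fun w => (n w j 0)%:E).
  apply: integrableS (square_integrable_integrable P _ (sn j)) => //.
have nDG : (\int[P]_(w in G) ((D *m n w) i 0)%:E = 0)%E.
  under eq_integral => w _ do rewrite mxE -sumEFin.
  rewrite integral_sum// => [|j].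
    by apply: big1 => j _; under eq_integral => w _ do rewrite EFinM;
      rewrite integralZl// nG mule0.
  by under eq_fun => w do rewrite EFinM; exact: integrableZl.
under [RHS]eq_integral => w _ do rewrite mxE EFinD.
rewrite integralD//; first by rewrite nDG adde0.
- by apply: integrableS (square_integrable_integrable P _ sC).
- by apply: integrableS (square_integrable_integrable P _ sD).
Qed.

End ConditionalExpectation.

(** * Positivity of second moments and the degenerate case *)

Section SecondMomentPositivity.
Context {d : measure_display} {T : measurableType d} {R : realType}
  (P : probability T R).

Lemma second_moment_diag_ge0 {k} (u : T -> 'cV[R]_k) i :
  0 <= second_moment P u u i i.
Proof. by rewrite mxE; apply: Rintegral_ge0 => w _; rewrite -expr2 sqr_ge0. Qed.

Lemma second_moment_trace_ge0 {k} (u : T -> 'cV[R]_k) :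
  0 <= \tr (second_moment P u u).
Proof. by apply: sumr_ge0 => i _; exact: second_moment_diag_ge0. Qed.

(** A vanishing sum of nonnegative diagonal entries forces each coordinate of [u] to be zero almost
    surely, and with it every product with [v]. Uniqueness of the minimizer rests on this. *)
Lemma second_moment_trace_eq0 {k l} (u : T -> 'cV[R]_k) (v : T -> 'cV[R]_l) :
  square_integrable_vec P u -> square_integrable_vec P v ->
  \tr (second_moment P u u) = 0 -> second_moment P u v = 0.
Proof.
move=> su sv /eqP; rewrite psumr_eq0 => [/allP tr0|i _]; last first.
  exact: second_moment_diag_ge0.
apply/matrixP => i j; rewrite !mxE.
have [mu iu2] := su i; have [mv _] := sv j.
have /eqP := tr0 i (mem_index_enum i); rewrite mxE => u2.
have ae0 : ae_eq P setT (fun w => (u w i 0 ^+ 2)%:E) (cst 0%E).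
  apply/ae_eq_integral_abs => //.
    by apply/measurable_EFinP; exact: measurable_funX.
  under eq_integral => w _ do rewrite gee0_abs ?lee_fin ?sqr_ge0//.
  by rewrite -[LHS]fineK ?integrable_fin_num//; congr EFin.
rewrite /Er /Eb (ae_eq_integral (cst 0%E)) ?integral0//.
  by apply/measurable_EFinP; exact: measurable_funM.
apply: filterS ae0 => w /= /(_ Logic.I) [] /eqP; rewrite sqrf_eq0 => /eqP -> _.
by rewrite mul0r.
Qed.

End SecondMomentPositivity.

(** * Completing the square and the push-through identity for matrices *)

Section LinearAlgebra.
Context {R : realType} {p m : nat} (H : 'M[R]_(m, p)) (S : 'M[R]_p)
  (N : 'M[R]_m) (lam : R).

(** The BCE cost when [S] and [N] are the second moments of [y] and [n]: the bias part has weight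
    [lam + 1], as it enters both the squared error and the penalty, while the noise part enters only
    the former. *)
Definition quadratic_cost (B : 'M[R]_(p, m)) : R :=
  (lam + 1) * \tr ((B *m H - 1%:M) *m S *m (B *m H - 1%:M)^T) +
  \tr (B *m N *m B^T).

(* The cross term vanishes because A solves the normal equations. *)
Lemma quadratic_cost_gap (A B : 'M[R]_(p, m)) :
  lam + 1 != 0 -> S^T = S -> N^T = N ->
  A *m (H *m S *m H^T + (lam + 1)^-1 *: N) = S *m H^T ->
  quadratic_cost B = quadratic_cost A +
    (lam + 1) * \tr ((B - A) *m H *m S *m ((B - A) *m H)^T) +
    \tr ((B - A) *m N *m (B - A)^T).
Proof.
move=> l0 ST NT AM; rewrite /quadratic_cost.
set D := B - A; set C := A *m H - 1%:M.
have -> : B = A + D by rewrite /D addrC subrK.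
have -> : (A + D) *m H - 1%:M = C + D *m H by rewrite mulmxDl addrAC.
(* Symmetry of [W] makes the two mixed traces equal, since a trace is invariant under
   transposition. *)
have expand k (U V : 'M[R]_(p, k)) (W : 'M[R]_k) : W^T = W ->
    \tr ((U + V) *m W *m (U + V)^T) =
    \tr (U *m W *m U^T) + 2 * \tr (U *m W *m V^T) + \tr (V *m W *m V^T).
  move=> WT; rewrite linearD/= !mulmxDl !mulmxDr !linearD/=.
  have -> : \tr (V *m W *m U^T) = \tr (U *m W *m V^T).
    by rewrite -mxtrace_tr !trmx_mul trmxK WT mulmxA.
  by ring.
rewrite !expand//.
have cross : (lam + 1) * \tr (C *m S *m (D *m H)^T) + \tr (A *m N *m D^T) = 0.
  rewrite -mxtraceZ -linearD/=.
  rewrite trmx_mul mulmxA scalemxAl -mulmxDl.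
  have -> : (lam + 1) *: (C *m S *m H^T) + A *m N = 0; last first.
    by rewrite mul0mx linear0.
  (* Replacing [S *m H^T] by the left side of the normal equations reduces [C *m S *m H^T] to
     [- (A *m ((lam + 1)^-1 *: N))]. *)
  rewrite /C !mulmxBl mul1mx -AM mulmxDr !mulmxA opprD addrA subrr sub0r.
  by rewrite scalerN -scalemxAr scalerA divff// scale1r addrC subrr.
rewrite mulrDr mulrDr; move: cross.
set a := \tr _; set b := \tr _; set c := \tr _; set e := \tr _; set f := \tr _.
by move=> cross; lra.
Qed.

(** Clearing both inverses leaves [W *m S *m H^T = H^T *m invmx N *m M], where each side expands to
    [H^T *m invmx N *m H *m S *m H^T + c *: H^T]. *)
Lemma linear_bce_push_through :
  let c := (lam + 1)^-1 in
  S \in unitmx -> N \in unitmx ->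
  H *m S *m H^T + c *: N \in unitmx ->
  H^T *m invmx N *m H + c *: invmx S \in unitmx ->
  S *m H^T *m invmx (H *m S *m H^T + c *: N) =
  invmx (H^T *m invmx N *m H + c *: invmx S) *m H^T *m invmx N.
Proof.
move=> c uS uN uM uW.
set M := _ + _ in uM *; set W := _ + _ in uW *.
have key : W *m S *m H^T = H^T *m invmx N *m M.
  rewrite /W /M !mulmxDl mulmxDr !mulmxA; congr (_ + _).
  by rewrite -!scalemxAl -scalemxAr mulVmx// mul1mx -mulmxA mulVmx// mulmx1.
apply: (can_inj (mulKmx uW)); rewrite !mulmxA mulmxV// mul1mx key.
by rewrite mulmxK.
Qed.

End LinearAlgebra.

(** * Optimality, uniqueness and the two closed forms of the linear BCE *)

Theorem theorem2 (d : measure_display) (T : measurableType d) (R : realType)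
  (P : probability T R) (p m : nat) (H : 'M[R]_(m, p))
  (y : T -> 'cV[R]_p) (n : T -> 'cV[R]_m) (lam : R)
  (cond : 'M[R]_(p, m) -> T -> 'cV[R]_p) (condx : T -> 'cV[R]_m) :
  0 <= lam ->
  (forall i, measurable_fun setT (fun w => y w i 0)) ->
  (forall i, measurable_fun setT (fun w => n w i 0)) ->
  (forall i, P.-integrable setT (fun w => (y w i 0 ^+ 2)%:E)) ->
  (forall i, P.-integrable setT (fun w => (n w i 0 ^+ 2)%:E)) ->
  (forall i, Eb P (fun w => n w i 0) = 0%E) ->
  indep_vec P y n ->
  let x := fun w => H *m y w + n w in
  let Sigma_n := second_moment P n n in
  let Sigma_y := second_moment P y y in
  (forall B, is_condexp P y (fun w => B *m x w - y w) (cond B)) ->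
  is_condexp P y x condx ->
  let Rm := second_moment P condx condx in
  let Exx := second_moment P x x in
  let Eyx := second_moment P y x in
  Sigma_n \in unitmx ->
  Sigma_y \in unitmx ->
  ((lam + 1)^-1 *: Exx + (lam / (lam + 1)) *: Rm) \in unitmx ->
  (H^T *m invmx Sigma_n *m H + (lam + 1)^-1 *: invmx Sigma_y) \in unitmx ->
  let A := Eyx *m invmx ((lam + 1)^-1 *: Exx + (lam / (lam + 1)) *: Rm) in
  [/\ (forall B, (bce_cost P lam x y cond A <= bce_cost P lam x y cond B)%E),
      (forall B, (forall B', (bce_cost P lam x y cond B <= bce_cost P lam x y cond B')%E) ->
                 B = A) &
      A = invmx (H^T *m invmx Sigma_n *m H + (lam + 1)^-1 *: invmx Sigma_y)
            *m H^T *m invmx Sigma_n].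
Proof.
move=> lam0 my mn iy in2 n0 yn x Sn Sy hcond hcondx Rm Exx Eyx uSn uSy uM uW A.
have l1_gt0 : 0 < lam + 1 by rewrite ltr_wpDl.
have l1_neq0 : lam + 1 != 0 by rewrite gt_eqF.
have sy : square_integrable_vec P y by [].
have sn : square_integrable_vec P n by [].
have sHy := square_integrable_vec_mulmx P H y sy.
have yn0 : second_moment P y n = 0 by exact: second_moment_indep0.
have ny0 : second_moment P n y = 0 by rewrite -second_moment_tr yn0 trmx0.
have SyT : Sy^T = Sy by exact: second_moment_tr.
have SnT : Sn^T = Sn by exact: second_moment_tr.
(* Both [x] and the residual [B *m x - y] have the form [C *m y + D *m n]; the cross moments vanish
   by independence. *)
have smE k (C : 'M[R]_(k, p)) (D : 'M[R]_(k, m)) :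
    second_moment P (fun w => C *m y w + D *m n w)
      (fun w => C *m y w + D *m n w) = C *m Sy *m C^T + D *m Sn *m D^T.
  have sC := square_integrable_vec_mulmx P C y sy.
  have sD := square_integrable_vec_mulmx P D n sn.
  have sCD := square_integrable_vecD P _ _ sC sD.
  rewrite second_momentDl// !second_momentDr// !second_moment_mulmxl//.
  rewrite !second_moment_mulmxr// yn0 ny0 !mul0mx !mulmx0 addr0 add0r.
  by rewrite !mulmxA.
have xE : x = fun w => H *m y w + 1%:M *m n w.
  by apply/funext => w; rewrite mul1mx.
have resE B : (fun w => B *m x w - y w) =
    (fun w => (B *m H - 1%:M) *m y w + B *m n w).
  apply/funext => w; rewrite mulmxDr mulmxBl mul1mx mulmxA.
  by rewrite addrAC.
have RmE : Rm = H *m Sy *m H^T.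
  rewrite /Rm (@second_moment_ae_eq _ _ _ P _ condx (fun w => H *m y w)).
  - by rewrite second_moment_mulmxl// second_moment_mulmxr// mulmxA.
  - exact: condexp_measurable hcondx.
  - by move=> i; case: (sHy i).
  apply: condexp_unique hcondx _ => //.
  by rewrite xE; exact: condexp_affine_indep.
have ExxE : Exx = H *m Sy *m H^T + Sn.
  by rewrite /Exx xE smE trmx1 mulmx1 mul1mx.
have EyxE : Eyx = Sy *m H^T.
  by rewrite /Eyx second_momentDr// second_moment_mulmxr// yn0 addr0.
(* The two weights sum to 1 on the signal part common to [Exx] and [Rm]; the noise part occurs only
   in [Exx]. *)
have ME : (lam + 1)^-1 *: Exx + (lam / (lam + 1)) *: Rm =
    H *m Sy *m H^T + (lam + 1)^-1 *: Sn.
  rewrite ExxE RmE scalerDr addrAC -scalerDl.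
  by have -> : (lam + 1)^-1 + lam / (lam + 1) = 1; [field | rewrite scale1r].
have AM : A *m (H *m Sy *m H^T + (lam + 1)^-1 *: Sn) = Sy *m H^T.
  by rewrite /A -ME mulmxKV// EyxE.
(* [cond B] agrees almost surely with [(B *m H - 1%:M) *m y], by uniqueness of conditional
   expectation. *)
have costE B : bce_cost P lam x y cond B = (quadratic_cost H Sy Sn lam B)%:E.
  have sC := square_integrable_vec_mulmx P (B *m H - 1%:M) y sy.
  have sD := square_integrable_vec_mulmx P B n sn.
  rewrite /bce_cost (Eb_sqn P (fun w => B *m x w - y w)) resE; last first.
    exact: square_integrable_vecD.
  rewrite (@Eb_sqn_ae_eq _ _ _ P _ (cond B) (fun w => (B *m H - 1%:M) *m y w)).
  - rewrite Eb_sqn// smE second_moment_mulmxl// second_moment_mulmxr// mulmxA.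
    rewrite -EFinM -EFinD /quadratic_cost linearD/=; congr EFin.
    by ring.
  - exact: condexp_measurable (hcond B).
  - by move=> i; case: (sC i).
  apply: condexp_unique (hcond B) _ => //.
  by rewrite resE; exact: condexp_affine_indep.
have gap B := quadratic_cost_gap H Sy Sn lam A B l1_neq0 SyT SnT AM.
(* The trace is that of the second moment of [(B - A) *m H *m y]. *)
have ge0y B : 0 <= (lam + 1) * \tr ((B - A) *m H *m Sy *m ((B - A) *m H)^T).
  apply: mulr_ge0; first exact: ltW.
  rewrite -mulmxA -second_moment_mulmxr// -second_moment_mulmxl//.
    exact: second_moment_trace_ge0.
  exact: square_integrable_vec_mulmx.
have trn B : \tr ((B - A) *m Sn *m (B - A)^T) =
    \tr (second_moment P (fun w => (B - A) *m n w) (fun w => (B - A) *m n w)).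
  rewrite second_moment_mulmxl//; last exact: square_integrable_vec_mulmx.
  by rewrite second_moment_mulmxr// mulmxA.
have ge0n B : 0 <= \tr ((B - A) *m Sn *m (B - A)^T).
  by rewrite trn; exact: second_moment_trace_ge0.
split.
- move=> B; rewrite !costE lee_fin (gap B).
  by have := ge0y B; have := ge0n B; lra.
- move=> B /(_ A); rewrite !costE lee_fin (gap B) => leBA.
  (* A minimizer [B] costs no more than [A], so the two nonnegative gap terms have sum at most
     zero. *)
  have tr0 : \tr ((B - A) *m Sn *m (B - A)^T) = 0.
    by apply/eqP; rewrite eq_le ge0n andbT; have := ge0y B; lra.
  (* This is the cross moment of [(B - A) *m n] with [n], whose first factor has zero mean square;
     invertibility of [Sn] then gives [B = A]. *)
  have : (B - A) *m Sn = 0.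
    rewrite -second_moment_mulmxl//; apply: second_moment_trace_eq0 => //.
      exact: square_integrable_vec_mulmx.
    by rewrite -trn.
  move/(congr1 (mulmx^~ (invmx Sn))); rewrite mulmxK// mul0mx => /eqP.
  by rewrite subr_eq0 => /eqP.
- rewrite /A ME EyxE; apply: linear_bce_push_through => //.
  by rewrite -ME.
Qed.
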